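(* Let $m>2$ and $n\ge 0$ be integers. The parameterized family of games generalized-rock-paper-scissors-with-duds with parameters $m,n$ (where the permutation $f$ is unknown to player 1) is guaranteed BL-WoLF-learnable with loss $m-1$ if $m$ is even, and with loss $m$ if $m$ is odd. If $n=0$, it is guaranteed BL-WoLF-learnable with loss $0$.
   Context: Stage game. There are two players, player 1 (the learner) and player 2 (the opponent), with finite action sets $A_1, A_2$. Each pair of actions determines (deterministically, or through a probability distribution) a pair of utilities; the game is zero-sum (the utilities sum to a constant). A stage-game strategy for player $i$ is a probability distribution over $A_i$. The value $V$ of the game is $V=\max_{\sigma_1}\min_{\sigma_2}E[u_1\mid\sigma_1,\sigma_2]$, and $\sigma_1$ is a maximin strategy for player 1 if it guarantees player 1 expected utility at least $V$ against every $\sigma_2$. Repeated game. A parameterized family of stage games consists of fixed action sets $A_1,A_2$, a parameter set $K$, and a map sending each $k\in K$ to a zero-sum stage game with these action sets. One $k \in K$ is fixed, and the corresponding stage game is played over and over. Player 2 knows $k$ and player 1's learning strategy; player 1 knows only the family. After each round player 1 observes both actions and the payoffs. A learning strategy for player 1 prescribes a stage-game strategy for each history of past actions and payoffs; the opponent may likewise use any history-dependent strategy. Player 1's loss in a round is $V$ (the value of the actual stage game) minus the utility player 1 received in that round; the loss incurred over several rounds is the sum of the losses of those rounds. Guaranteed BL-WoLF-learnability. A parameter value is consistent with a history if that history's observed payoffs are possible under it given the actions. Player 1 has learned enough to construct a maximin strategy once there is a single stage-game strategy of player 1 that is a maximin strategy in every game of the family consistent with the history so far. A family is guaranteed BL-WoLF-learnable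 with loss $l$ if there exists a learning strategy for player 1 such that, for any game in the family and against any opponent, the cumulative loss incurred by player 1 before learning enough about the game to construct a maximin strategy (that is, at any time up to and including the round in which this is learned, or at all times if it is never learned) is never more than $l$. The family generalized-rock-paper-scissors-with-duds. For given $m>2$ and $n$ (known to both players), both players have action set $A=\{1,2,\ldots,m+n\}$. The outcome is determined by a permutation $f:\{1,\ldots,m+n\}\to\{1,\ldots,m+n\}$ (the unknown parameter). The set of duds is $\{i: m+1\le f(i)\le m+n\}$. Given actions $a_1,a_2$ (and writing $-i$ for the player other than $i$): if exactly one player plays a dud, that player loses; if neither player plays a dud and $f(a_i)\equiv f(a_{-i})+1 \pmod m$, player $i$ wins; otherwise there is a draw. Winning gives utility $1$, losing gives utility $-1$, a draw gives utility $0$ to both. Player 1 initially does not know $f$. *)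

(* Defs.v *)
From HB Require Import structures.
From mathcomp Require Import all_boot all_order all_algebra perm finmap.
From mathcomp Require Import classical_sets reals.

Set Implicit Arguments.
Unset Strict Implicit.
Unset Printing Implicit Defensive.

Import Order.TTheory GRing.Theory Num.Theory.
Local Open Scope ring_scope.

Record mixed (R : realType) (A : finType) := Mixed {
  weight :> {ffun A -> R};
  weight_ge0 : forall a, 0 <= weight a;
  weight_sum1 : \sum_a weight a = 1 }.

Record fdist (R : realType) (T : choiceType) := FDist {
  pmf :> {fsfun T -> R with 0};
  pmf_ge0 : forall x, 0 <= pmf x;
  pmf_sum1 : \sum_(x <- finsupp pmf) pmf x = 1 }.

(* [payoff g a1 a2] is the joint law of the utilities [(u1, u2)]; a game with
   deterministic payoffs is one all of whose laws are Dirac masses.  A pair of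
   utilities is possible when it has positive probability. *)
Record stage_game (R : realType) (A1 A2 : finType) := StageGame {
  payoff : A1 -> A2 -> fdist R (R * R)%type;
  zero_sum : exists c : R, forall a1 a2 u,
    0 < payoff a1 a2 u -> u.1 + u.2 = c }.

Section StageGame.
Context (R : realType) (A1 A2 : finType).
Implicit Types (g : stage_game R A1 A2) (sigma : mixed R A1) (tau : mixed R A2).

Definition expected_utility1 g sigma tau : R :=
  \sum_a1 \sum_a2 sigma a1 * tau a2 *
    \sum_(u <- finsupp (payoff g a1 a2)) payoff g a1 a2 u * u.1.

(* For nonempty [A1], [A2] the extrema are attained (mixed strategies form
   compact spaces), so this is max_sigma min_tau E[u1 | sigma, tau]. *)
Definition value g : R :=
  sup (range (fun sigma => inf (range (fun tau => expected_utility1 g sigma tau)))).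

Definition maximin g sigma : Prop :=
  forall tau, value g <= expected_utility1 g sigma tau.

End StageGame.

Section RepeatedGame.
Context (R : realType) (A1 A2 : finType) (K : Type).
Implicit Types (g : stage_game R A1 A2) (G : K -> stage_game R A1 A2).

(* A round is [(a1, a2, (u1, u2))]; histories are chronological. *)
Definition history : Type := seq (A1 * A2 * (R * R)).

(* The histories that occur with positive probability when the stage game [g]
   is played over and over with the strategies [S1] and [S2]. *)
Inductive play g (S1 : history -> mixed R A1) (S2 : history -> mixed R A2) :
    history -> Prop :=
| play_nil : play g S1 S2 [::]
| play_rcons h a1 a2 u : play g S1 S2 h ->
    0 < S1 h a1 -> 0 < S2 h a2 -> 0 < payoff g a1 a2 u ->
    play g S1 S2 (rcons h (a1, a2, u)).

Definition loss g (h : history) : R := \sum_(r <- h) (value g - r.2.1).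

Definition consistent g (h : history) : bool :=
  all (fun r => 0 < payoff g r.1.1 r.1.2 r.2) h.

Definition learned G (h : history) : Prop :=
  exists sigma : mixed R A1, forall k, consistent (G k) h -> maximin (G k) sigma.

(* A history none of whose strict prefixes is [learned] ends no later than the
   round in which player 1 learns enough.  The bound is on the realized loss. *)
Definition guaranteed_BL_WoLF_learnable G (l : R) : Prop :=
  exists S1 : history -> mixed R A1,
  forall (k : K) (S2 : history -> mixed R A2) (h : history),
    play (G k) S1 S2 h ->
    (forall t, (t < size h)%N -> ~ learned G (take t h)) ->
    loss (G k) h <= l.

End RepeatedGame.

Section Dirac.
Context (R : realType) (T : choiceType) (x : T).

Definition dirac_pmf : {fsfun T -> R with 0} := [fsfun y in [fset x]%fset => 1].

Lemma dirac_pmfE y : dirac_pmf y = (y == x)%:R.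
Proof. by rewrite fsfunE inE; case: eqP. Qed.

Lemma dirac_pmf_ge0 y : 0 <= dirac_pmf y.
Proof. by rewrite dirac_pmfE ler0n. Qed.

Lemma dirac_pmf_sum1 : \sum_(y <- finsupp dirac_pmf) dirac_pmf y = 1.
Proof.
have -> : finsupp dirac_pmf = [fset x]%fset.
  by apply/fsetP => y; rewrite mem_finsupp dirac_pmfE inE pnatr_eq0 eqb0 negbK.
by rewrite big_seq_fset1 dirac_pmfE eqxx.
Qed.

Definition dirac : fdist R T := FDist dirac_pmf_ge0 dirac_pmf_sum1.

End Dirac.

(* Actions and values of the permutation [f] are numbered from 0 in ['I_(m + n)]
   and from 1 in the mathematical description, hence the successors below. *)
Section GRPSDuds.
Context (R : realType) (m n : nat).
Implicit Types (f : {perm 'I_(m + n)}) (a b : 'I_(m + n)).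

Definition dud f a : bool := (m + 1 <= (f a).+1 <= m + n)%N.

(* The player who plays [a] wins against an opponent who plays [b]. *)
Definition wins f a b : bool :=
  (~~ dud f a && dud f b) ||
  [&& ~~ dud f a, ~~ dud f b & ((f a).+1 == (f b).+1 + 1 %[mod m])%N].

Definition utility f a b : R :=
  if wins f a b then 1 else if wins f b a then -1 else 0.

Lemma wins_asym f a b : (2 < m)%N -> wins f a b -> wins f b a -> False.
Proof.
move=> hm; rewrite /wins; case: (dud f a); case: (dud f b) => //=.
move=> /eqP e1 /eqP e2.
have : ((f a).+1 + 2 = (f a).+1 + 0 %[mod m])%N.
  by rewrite addn0 e1 -(modnDml (f b).+1) e2 modnDml -addnA.
by move/eqP; rewrite eqn_modDl mod0n modn_small.
Qed.

Lemma grps_zero_sum (hm : (2 < m)%N) f : exists c : R, forall a b u,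
  0 < dirac R (utility f a b, utility f b a) u -> u.1 + u.2 = c.
Proof.
exists 0 => a b u; rewrite dirac_pmfE ltr0n lt0b => /eqP -> /=.
rewrite /utility; have := @wins_asym f a b hm.
case: (wins f a b); case: (wins f b a) => // H;
  by [case: H | rewrite ?subrr ?addNr ?addr0].
Qed.

Definition grps_with_duds (hm : (2 < m)%N) f :
    stage_game R 'I_(m + n) 'I_(m + n) :=
  StageGame (grps_zero_sum hm f).

End GRPSDuds.

Arguments grps_with_duds : clear implicits.

(* Main.v *)
Require Import Defs.
From HB Require Import structures.
From mathcomp Require Import all_boot all_order all_algebra perm finmap.
From mathcomp Require Import classical_sets reals.
From mathcomp Require Import zify lra.

Set Implicit Arguments.
Unset Strict Implicit.
Unset Printing Implicit Defensive.

Import Order.TTheory GRing.Theory Num.Theory.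
Local Open Scope ring_scope.

(** The learner repeats the action that most recently beat it.  The first loss
    reveals a non-dud [b_0]; from then on the learner plays a known non-dud
    [b_j], which loses only to its successor [b_(j+1)] in the cycle.  Hence [l]
    losses reveal [l] cyclically consecutive non-duds.  The strategy choosing
    [b_(2i mod m)] with [i] uniform below [m] is maximin, because for an action
    [b] in position [y] the position [y + 1] and the position [y - 1] are hit
    equally often by [2i].  If [m] is odd it needs all [m] non-duds, if [m] is
    even only [b_0, ..., b_(m-2)].  Without duds the uniform strategy is maximin
    whatever the permutation. *)

(** * Images of uniform laws as mixed strategies *)

Section PushforwardUniform.
Context (R : realType) (I A : finType) (i0 : I) (c : I -> A).

Definition pushforward_uniform_weight : {ffun A -> R} :=
  [ffun a => (\sum_i (c i == a)%:R) / #|I|%:R].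

Lemma pushforward_uniform_weight_ge0 a : 0 <= pushforward_uniform_weight a.
Proof. by rewrite ffunE divr_ge0 ?ler0n ?sumr_ge0. Qed.

Lemma pushforward_uniform_sum (F : A -> R) :
  \sum_a pushforward_uniform_weight a * F a = (\sum_i F (c i)) / #|I|%:R.
Proof.
under eq_bigr => a _ do rewrite ffunE mulrAC mulr_suml.
rewrite -mulr_suml exchange_big; congr (_ / _); apply: eq_bigr => i _ /=.
rewrite (bigD1 (c i)) //= eqxx mul1r big1 ?addr0 // => a.
by rewrite eq_sym => /negPf->; rewrite mul0r.
Qed.

Lemma pushforward_uniform_weight_sum1 : \sum_a pushforward_uniform_weight a = 1.
Proof.
have -> : \sum_a pushforward_uniform_weight a =
    \sum_a pushforward_uniform_weight a * 1.
  by apply: eq_bigr => a _; rewrite mulr1.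
rewrite (pushforward_uniform_sum (fun=> 1)) sumr_const divff //.
by rewrite pnatr_eq0 -lt0n; apply/card_gt0P; exists i0.
Qed.

(** Pure strategies are the case of a one-point [I], the uniform strategy the case [c = id]. The
    point [i0] keeps the denominator nonzero. *)
Definition pushforward_uniform : mixed R A :=
  Mixed pushforward_uniform_weight_ge0 pushforward_uniform_weight_sum1.

Lemma pushforward_uniform_gt0 a : 0 < pushforward_uniform a -> exists i, c i = a.
Proof.
case: (pickP (fun i => c i == a)) => [i /eqP <- _|ca]; first by exists i.
by rewrite ffunE big1 ?mul0r ?ltxx // => i _; rewrite ca.
Qed.

End PushforwardUniform.

(** Adding [h 0 = h N] turns either side into the sum of [h] over [0, ..., N]. *)
Lemma sum_shift_period (R : realType) (N : nat) (h : nat -> R) :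
  h N = h 0%N -> \sum_(i < N) h i.+1 = \sum_(i < N) h i.
Proof.
move=> hN; apply: (addrI (h 0%N)).
by rewrite -(big_ord_recl N h) big_ord_recr /= hN addrC.
Qed.

(** * The value of the game and a criterion for maximin strategies *)

Section Game.
Context (R : realType) (m n : nat) (hm : (2 < m)%N).
Implicit Types (f : {perm 'I_(m + n)}) (a b : 'I_(m + n)).
Local Notation G := (grps_with_duds R m n hm).

Lemma payoff_gt0 f a b (u : R * R) :
  0 < payoff (G f) a b u -> u = (utility R f a b, utility R f b a).
Proof. by rewrite /= dirac_pmfE ltr0n lt0b => /eqP. Qed.

Lemma utility_anti f a b : utility R f a b = - utility R f b a.
Proof.
rewrite /utility; have := @wins_asym m n f a b hm.
case: (wins f a b); case: (wins f b a) => // H; rewrite ?opprK ?oppr0 //.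
by case: H.
Qed.

Lemma utility_geN1 f a b : -1 <= utility R f a b.
Proof. by rewrite /utility; do 2?case: ifP => _; lra. Qed.

Lemma utility_eqN1 f a b : utility R f a b = -1 -> wins f b a.
Proof. by rewrite /utility; do 2?case: ifP => // _; move=> ?; lra. Qed.

Lemma utility_difference f a b :
  utility R f a b = (wins f a b)%:R - (wins f b a)%:R.
Proof.
rewrite /utility; have := @wins_asym m n f a b hm.
by case: (wins f a b); case: (wins f b a) => H /=; [case: H|lra..].
Qed.

Lemma expected_utility1_grps f (sigma tau : mixed R 'I_(m + n)) :
  expected_utility1 (G f) sigma tau =
  \sum_a sigma a * \sum_b tau b * utility R f a b.
Proof.
apply: eq_bigr => a _; rewrite mulr_sumr; apply: eq_bigr => b _.
rewrite -mulrA; congr (_ * (_ * _)) => /=.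
set x := (_, _); rewrite (_ : finsupp _ = [fset x]%fset).
  by rewrite big_seq_fset1 dirac_pmfE eqxx mul1r.
by apply/fsetP => y; rewrite mem_finsupp dirac_pmfE inE pnatr_eq0 eqb0 negbK.
Qed.

(** Swapping the two players negates the utility, so this number is its own opposite. *)
Lemma expected_utility1_self f (sigma : mixed R 'I_(m + n)) :
  expected_utility1 (G f) sigma sigma = 0.
Proof.
rewrite expected_utility1_grps; set E := LHS.
suff : E = - E by move=> ?; lra.
rewrite /E; under eq_bigr => a _ do rewrite mulr_sumr.
rewrite {1}exchange_big -sumrN; apply: eq_bigr => b _.
rewrite -sumrN; apply: eq_bigr => a _.
by rewrite utility_anti !mulrN mulrCA.
Qed.

(** Supplies the lower bound that [ge_inf] requires in [value_le0]. *)
Lemma expected_utility1_geN1 f (sigma tau : mixed R 'I_(m + n)) :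
  -1 <= expected_utility1 (G f) sigma tau.
Proof.
rewrite expected_utility1_grps -(weight_sum1 sigma) -sumrN.
apply: ler_sum => a _; rewrite -[leLHS]mulrN1 ler_wpM2l ?weight_ge0 //.
rewrite -(weight_sum1 tau) -sumrN; apply: ler_sum => b _.
by rewrite -[leLHS]mulrN1 ler_wpM2l ?weight_ge0 ?utility_geN1.
Qed.

(** The opponent can copy [sigma], so no [sigma] guarantees more than 0. *)
Lemma value_le0 f : value (G f) <= 0.
Proof.
have m0 : (0 < m + n)%N by lia.
apply: ge_sup => [|_ [sigma _ <-]].
  exists (inf (range (expected_utility1 (G f)
    (pushforward_uniform R tt (fun=> Ordinal m0))))).
  by exists (pushforward_uniform R tt (fun=> Ordinal m0)).
rewrite -(expected_utility1_self f sigma); apply: ge_inf.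
  by exists (-1) => _ [tau _ <-]; apply: expected_utility1_geN1.
by exists sigma.
Qed.

(** As the value is at most 0, guaranteeing 0 suffices; by linearity in [tau] this is checked
    against pure actions [b]. *)
Lemma maximin_pushforward_uniform f (I : finType) (i0 : I) (c : I -> 'I_(m + n)) :
  (forall b, 0 <= \sum_i utility R f (c i) b) ->
  maximin (G f) (pushforward_uniform R i0 c).
Proof.
move=> c_ge0 tau; apply: le_trans (value_le0 f) _.
rewrite expected_utility1_grps pushforward_uniform_sum divr_ge0 //.
rewrite exchange_big sumr_ge0 // => b _ /=.
by rewrite -mulr_sumr mulr_ge0 ?weight_ge0.
Qed.

(** * Cyclic sums of utilities *)

Lemma utility_dud f a b : ~~ dud f a -> dud f b -> utility R f a b = 1.
Proof. by move=> ha hb; rewrite /utility /wins ha hb. Qed.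

Lemma wins_nondud f a b : ~~ dud f a -> ~~ dud f b ->
  wins f a b = (f a == f b + 1 %[mod m])%N.
Proof.
move=> na nb; rewrite /wins na nb (negPf nb) /=.
by rewrite -(addn1 (f a)) addSn -(addn1 (f b + 1)) eqn_modDr.
Qed.

(** The losing condition is shifted by 1, so that the two indicators differ only by a step of 2 in
    the position of [a]; sums along such steps telescope. *)
Lemma utility_nondud f a b : ~~ dud f a -> ~~ dud f b ->
  utility R f a b =
  (f a == f b + 1 %[mod m])%N%:R - (f a + 2 == f b + 1 %[mod m])%N%:R.
Proof.
move=> ha hb; rewrite utility_difference !wins_nondud //.
by rewrite [X in _ - (nat_of_bool X)%:R]eq_sym -(eqn_modDr 1 (f a + 1)) -addnA.
Qed.

(** Against a non-dud the sum telescopes to [h 0 - h m], which vanishes since [2 * m] is 0 modulo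
    [m]. *)
Lemma two_step_sum_ge0 f (c : 'I_m -> 'I_(m + n)) x :
  (forall i, ~~ dud f (c i)) -> (forall i, f (c i) = x + 2 * i %[mod m])%N ->
  forall b, 0 <= \sum_i utility R f (c i) b.
Proof.
move=> nd fc b; have [bd|bd] := boolP (dud f b).
  by rewrite sumr_ge0 // => i _; rewrite utility_dud.
pose h i : R := (x + 2 * i == f b + 1 %[mod m])%N%:R.
have uE i : utility R f (c i) b = h i - h i.+1.
  by rewrite /h utility_nondud // fc -(modnDml (f (c i))) fc modnDml mulnSr addnA.
rewrite (eq_bigr _ (fun i _ => uE i)) sumrB (@sum_shift_period _ _ h) ?subrr //.
by rewrite /h muln0 -modnDmr modnMl.
Qed.

Lemma all_nondud_sum_ge0 f b : n = 0%N -> 0 <= \sum_a utility R f a b.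
Proof.
move=> n0; have nd a : ~~ dud f a by rewrite /dud; have := ltn_ord (f a); lia.
pose h i : R := (i == f b + 1 %[mod m])%N%:R.
have hP i : h (i + m)%N = h i by rewrite /h modnDr.
under eq_bigr => a _ do rewrite utility_nondud // -[_%:R]/(h _).
rewrite sumrB.
have reindexf (F : nat -> R) : \sum_a F (f a) = \sum_(i < m) F i.
  rewrite -(reindex_inj (@perm_inj _ f) (P := predT) (F := fun i => F (val i))).
  by rewrite -(big_mkord predT) n0 addn0 big_mkord.
rewrite (reindexf h) (reindexf (fun i => (i + 2 == f b + 1 %[mod m])%N%:R)).
(* Two shifts by 1 turn the first sum into the second. *)
rewrite -(sum_shift_period (h := h)); last by rewrite -(hP 0%N).
rewrite -(sum_shift_period (h := fun i => h i.+1)); last first.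
  by rewrite -(hP 1%N) addnC addn1.
by under eq_bigr => i _ do rewrite -addn2; rewrite subrr.
Qed.

(** * The imitation strategy and what its losses reveal *)

Definition beaten_by (h : history R 'I_(m + n) 'I_(m + n)) : seq 'I_(m + n) :=
  [seq r.1.2 | r <- h & r.2.1 == -1].

Lemma beaten_by_rcons h r : beaten_by (rcons h r) =
  if r.2.1 == -1 then rcons (beaten_by h) r.1.2 else beaten_by h.
Proof. by rewrite /beaten_by filter_rcons; case: ifP; rewrite ?map_rcons. Qed.

Section Strategy.
Context (a0 : 'I_(m + n)).

(** The default [a0], played until the first loss, may be a dud. *)
Definition imitate (h : history R 'I_(m + n) 'I_(m + n)) : mixed R 'I_(m + n) :=
  pushforward_uniform R tt (fun=> last a0 (beaten_by h)).

Context (f : {perm 'I_(m + n)})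
  (S2 : history R 'I_(m + n) 'I_(m + n) -> mixed R 'I_(m + n)).

(** Since the value is at most 0, a lost round costs at most 1 and any other round at most 0. *)
Lemma loss_imitate h : play (G f) imitate S2 h ->
  loss (G f) h <= (size (beaten_by h))%:R.
Proof.
elim=> [|{}h a b u _ IH _ _ /payoff_gt0 ->]; first by rewrite /loss big_nil.
have := value_le0 f; have := utility_geN1 f a b.
rewrite /loss -cats1 big_cat big_seq1 /= -/(loss _ _) cats1 beaten_by_rcons /=.
case: eqP => [->|]; first by rewrite size_rcons -natr1; lra.
by rewrite /utility; do 2?case: ifP => _ //; lra.
Qed.

(** Stated for every consistent [f'], not just the true [f], because [learned] asks for one strategy
    that is maximin for all of them. *)
Lemma beaten_by_chain f' h : play (G f) imitate S2 h -> consistent (G f') h ->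
  forall j, (j < size (beaten_by h))%N ->
    ~~ dud f' (nth a0 (beaten_by h) j) /\
    (f' (nth a0 (beaten_by h) j) = f' (nth a0 (beaten_by h) 0) + j %[mod m])%N.
Proof.
elim=> [|{}h a b u _ IH /pushforward_uniform_gt0[_ <-] {a} _ _] //.
rewrite /consistent all_rcons beaten_by_rcons => /andP[/payoff_gt0 /= -> /IH{}IH].
case: eqP => [/utility_eqN1 bwins|_ //] j; move: IH bwins.
set s := beaten_by h; set a := last a0 s => IH.
rewrite size_rcons ltnS leq_eqVlt nth_rcons => bwins.
case/predU1P => [->|js]; last first.
  by rewrite js nth_rcons (leq_ltn_trans _ js) //; apply: IH.
rewrite ltnn eqxx.
have nb : ~~ dud f' b by move: bwins; rewrite /wins; case: (dud f' b).
(* At the first loss [b] is itself the reference position; later [b] beats the known non-dud [a],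
   hence is its successor. *)
split=> //; rewrite nth_rcons; have [/size0nil ->|s0] := posnP (size s).
  by rewrite addn0.
have [na fa] : ~~ dud f' a /\
    (f' a = f' (nth a0 s 0) + (size s).-1 %[mod m])%N.
  by rewrite /a -nth_last; apply: IH; rewrite prednK.
move: bwins; rewrite wins_nondud // => /eqP ->.
by rewrite -modnDml fa modnDml -addnA addn1 prednK.
Qed.

Definition losses_to_learn : nat := (m - ~~ odd m)%N.

(** For even [m] the residue is even, so it cannot be [m - 1]. *)
Lemma two_step_lt_losses i : (i < m)%N -> ((2 * i) %% m < losses_to_learn)%N.
Proof.
move=> im; rewrite /losses_to_learn; have lt := ltn_pmod (2 * i) (ltnW (ltnW hm)).
have [|em] := boolP (odd m); first by rewrite subn0.
have : ~~ odd ((2 * i) %% m).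
  by rewrite odd_mod ?oddM //; apply: negPf.
move: lt em; set x := ((2 * i) %% m)%N; rewrite /=; lia.
Qed.

Lemma learned_imitate h : play (G f) imitate S2 h ->
  (losses_to_learn <= size (beaten_by h))%N -> learned G h.
Proof.
move=> ph sh; pose c (i : 'I_m) := nth a0 (beaten_by h) ((2 * i) %% m).
exists (pushforward_uniform R (Ordinal (ltnW (ltnW hm))) c) => f' cf'.
have chain i := beaten_by_chain ph cf' (leq_trans (two_step_lt_losses (ltn_ord i)) sh).
apply: maximin_pushforward_uniform.
apply: (@two_step_sum_ge0 _ _ (f' (nth a0 (beaten_by h) 0))) => i.
  by have [] := chain i.
by have [_ ->] := chain i; rewrite modnDmr.
Qed.

(** Before the last round too few losses had occurred for learning, and that round adds at most
    one. *)
Lemma beaten_by_bound h : play (G f) imitate S2 h ->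
  (forall t, (t < size h)%N -> ~ learned G (take t h)) ->
  (size (beaten_by h) <= losses_to_learn)%N.
Proof.
case=> // {}h a b u ph _ _ _ /(_ (size h)).
rewrite size_rcons ltnSn -cats1 take_size_cat // => /(_ isT) nl.
rewrite cats1 beaten_by_rcons.
have : (size (beaten_by h) < losses_to_learn)%N.
  by rewrite ltnNge; apply/negP => /(learned_imitate ph).
by case: ifP; rewrite ?size_rcons // => _ /ltnW.
Qed.

End Strategy.

Lemma learnable_losses_to_learn :
  guaranteed_BL_WoLF_learnable G (losses_to_learn)%:R.
Proof.
have m0 : (0 < m + n)%N by lia.
exists (imitate (Ordinal m0)) => f S2 h ph nl.
apply: le_trans (loss_imitate ph) _.
by rewrite ler_nat (beaten_by_bound ph).
Qed.

Lemma learnable_no_duds : n = 0%N -> guaranteed_BL_WoLF_learnable G 0.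
Proof.
move=> n0; have m0 : (0 < m + n)%N by lia.
pose uniform := pushforward_uniform R (Ordinal m0) id.
exists (fun=> uniform) => f S2 [|r h] _ nl; first by rewrite /loss big_nil.
(* The empty history is already learned, so a nonempty one contradicts [nl]. *)
case: (nl 0%N) => //; exists uniform => f' _.
by apply: maximin_pushforward_uniform => b; apply: all_nondud_sum_ge0.
Qed.

End Game.

Theorem theorem3 (R : realType) (m n : nat) (hm : (2 < m)%N) :
  [/\ ~~ odd m ->
        guaranteed_BL_WoLF_learnable (grps_with_duds R m n hm) (m%:R - 1),
      odd m ->
        guaranteed_BL_WoLF_learnable (grps_with_duds R m n hm) m%:R
    & n = 0%N ->
        guaranteed_BL_WoLF_learnable (grps_with_duds R m n hm) 0].
Proof.
have := learnable_losses_to_learn R n hm; rewrite /losses_to_learn => main.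
split=> [em|om|]; last exact: learnable_no_duds.
- by move: main; rewrite em natrB // ltnW // ltnW.
- by move: main; rewrite om subn0.
Qed.
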